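(* Let $M,N\ge1$ be integers, $P,\sigma^2,\beta_1,\beta_2,\beta_3,\alpha_{\rm A\text{-}RIS}>0$, $\alpha_{\rm NCR}\ge0$, let $\mathbf{a}_{2,1}\in\mathbb{C}^M$ have unit-modulus entries, and let $\mathbf{R}_3\in\mathbb{C}^{M\times M}$ be positive semidefinite with $\mathrm{tr}(\mathbf{R}_3)=M\beta_3$. Define the wideband average SNRs $$\overline{\mathrm{SNR}}_{\rm P\text{-}RIS}=\frac{P\left(\beta_3M+\beta_1\beta_2N^2M\right)}{\sigma^2},$$ $$\overline{\mathrm{SNR}}_{\rm A\text{-}RIS}=\frac{P\alpha_{\rm A\text{-}RIS}^2M\beta_1\beta_2N^2-P\alpha_{\rm A\text{-}RIS}^2\beta_2N\,\mathbf{a}_{2,1}^{H}\mathbf{R}_3\mathbf{a}_{2,1}}{\sigma^2(1+\alpha_{\rm A\text{-}RIS}^2\beta_2MN)}+\frac{P\beta_3M}{\sigma^2},$$ $$\overline{\mathrm{SNR}}_{\rm NCR}=\frac{P\alpha_{\rm NCR}^2M\beta_1\beta_2-P\alpha_{\rm NCR}^2\beta_2\,\mathbf{a}_{2,1}^{H}\mathbf{R}_3\mathbf{a}_{2,1}}{\sigma^2(1+\alpha_{\rm NCR}^2\beta_2M)}+\frac{P\beta_3M}{\sigma^2}.$$ Suppose $\mathbf{a}_{2,1}$ lies in the null space of $\mathbf{R}_3$, i.e. $\mathbf{a}_{2,1}^{H}\mathbf{R}_3\mathbf{a}_{2,1}=0$. Then the conditions for the NCR to outperform the RISs coincide with those in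 the absence of a direct link: (a) If $1-N^2M\beta_2>0$, then $\overline{\mathrm{SNR}}_{\rm NCR}\ge\overline{\mathrm{SNR}}_{\rm P\text{-}RIS}$ if and only if $\alpha_{\rm NCR}\ge\frac{N}{\sqrt{1-N^2M\beta_2}}$; if $N^2M\beta_2\ge1$, then $\overline{\mathrm{SNR}}_{\rm P\text{-}RIS}>\overline{\mathrm{SNR}}_{\rm NCR}$ for every $\alpha_{\rm NCR}\ge0$. (b) If $1-(N^2-N)\alpha_{\rm A\text{-}RIS}^2M\beta_2>0$, then $\overline{\mathrm{SNR}}_{\rm NCR}\ge\overline{\mathrm{SNR}}_{\rm A\text{-}RIS}$ if and only if $\alpha_{\rm NCR}\ge\frac{\alpha_{\rm A\text{-}RIS}N}{\sqrt{1-(N^2-N)\alpha_{\rm A\text{-}RIS}^2M\beta_2}}$; if $(N^2-N)\alpha_{\rm A\text{-}RIS}^2M\beta_2\ge1$, then $\overline{\mathrm{SNR}}_{\rm A\text{-}RIS}>\overline{\mathrm{SNR}}_{\rm NCR}$ for every $\alpha_{\rm NCR}\ge0$.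
   Context: $(\cdot)^H$ is the conjugate transpose. The quantities are average (over a random direct channel with spatial correlation matrix $\mathbf{R}_3$) uplink signal-to-noise ratios of wideband systems assisted by a passive RIS with $N$ elements, an active RIS with $N$ elements and per-element gain $\alpha_{\rm A\text{-}RIS}$, and a network-controlled repeater (NCR) with gain $\alpha_{\rm NCR}$; $M$ is the number of base station antennas. *)

(* Defs.v *)
From mathcomp Require Import all_boot all_order all_algebra.
From mathcomp Require Import sesquilinear spectral.
From mathcomp Require Import complex.
From mathcomp Require Import reals.

Set Implicit Arguments.
Unset Strict Implicit.
Unset Printing Implicit Defensive.

Import Order.TTheory GRing.Theory Num.Theory.
Local Open Scope ring_scope.
Local Open Scope complex_scope.
Local Open Scope sesquilinear_scope.

Section SNR.
Variable R : realType.

(* x^H A x; [^t*] is the conjugate transpose *)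
Definition quad_form (M : nat) (A : 'M[R[i]]_M) (x : 'cV[R[i]]_M) : R[i] :=
  (x ^t* *m A *m x) 0 0.

(* In the order of R[i], 0 <= z means that z is real and nonnegative. *)
Definition psdmx (M : nat) (A : 'M[R[i]]_M) : Prop :=
  A \is hermsymmx /\ forall x : 'cV[R[i]]_M, 0 <= quad_form A x.

(* [sigma2] is the noise variance, i.e. already a square. *)
Definition SNR_PRIS (M N : nat) (P sigma2 beta1 beta2 beta3 : R) : R :=
  P * (beta3 * M%:R + beta1 * beta2 * N%:R ^+ 2 * M%:R) / sigma2.

(* Taking the real part of the quadratic form
   loses nothing: it is real whenever [R3] is Hermitian. *)
Definition SNR_ARIS (M N : nat) (P sigma2 beta1 beta2 beta3 : R)
    (a21 : 'cV[R[i]]_M) (R3 : 'M[R[i]]_M) (alpha : R) : R :=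
  (P * alpha ^+ 2 * M%:R * beta1 * beta2 * N%:R ^+ 2
     - P * alpha ^+ 2 * beta2 * N%:R * complex.Re (quad_form R3 a21))
    / (sigma2 * (1 + alpha ^+ 2 * beta2 * M%:R * N%:R))
  + P * beta3 * M%:R / sigma2.

Definition SNR_NCR (M : nat) (P sigma2 beta1 beta2 beta3 : R)
    (a21 : 'cV[R[i]]_M) (R3 : 'M[R[i]]_M) (alpha : R) : R :=
  (P * alpha ^+ 2 * M%:R * beta1 * beta2
     - P * alpha ^+ 2 * beta2 * complex.Re (quad_form R3 a21))
    / (sigma2 * (1 + alpha ^+ 2 * beta2 * M%:R))
  + P * beta3 * M%:R / sigma2.

(* The same quantities without a direct link: the direct channel vanishes, so
   its gain and its correlation matrix are zero. *)
Definition SNR_PRIS_nodirect (M N : nat) (P sigma2 beta1 beta2 : R) : R :=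
  SNR_PRIS M N P sigma2 beta1 beta2 0.

Definition SNR_ARIS_nodirect (M N : nat) (P sigma2 beta1 beta2 : R)
    (a21 : 'cV[R[i]]_M) (alpha : R) : R :=
  SNR_ARIS N P sigma2 beta1 beta2 0 a21 0 alpha.

Definition SNR_NCR_nodirect (M : nat) (P sigma2 beta1 beta2 : R)
    (a21 : 'cV[R[i]]_M) (alpha : R) : R :=
  SNR_NCR P sigma2 beta1 beta2 0 a21 0 alpha.

End SNR.

(* Main.v *)
Require Import Defs.
From mathcomp Require Import all_boot all_order all_algebra.
From mathcomp Require Import sesquilinear spectral.
From mathcomp Require Import complex.
From mathcomp Require Import reals.
From mathcomp Require Import ring.
Import Order.TTheory GRing.Theory Num.Theory.
Local Open Scope ring_scope.
Local Open Scope complex_scope.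

(** Once the quadratic form vanishes, the direct link adds the same term
    P beta3 M / sigma2 to all three SNRs. The difference between the NCR and a
    RIS is then a positive factor times alpha^2 e - q^2, with q = N,
    e = 1 - N^2 M beta2 for the passive RIS and q = alphaA N,
    e = 1 - (N^2 - N) alphaA^2 M beta2 for the active one; for alpha >= 0 its
    sign is decided by comparing alpha with q / sqrt e if e > 0, and it is
    negative if e <= 0. *)

Lemma quad_form0 (R : realType) (M : nat) (x : 'cV[R[i]]_M) :
  quad_form 0 x = 0.
Proof. by rewrite /quad_form mulmx0 mul0mx mxE. Qed.

(** The right-hand side contains neither [beta3] nor [Q], so the lemma covers both the direct link
    and its absence, where [beta3 = 0] and [Q = 0]. As an equality of booleans it also rewrites
    negated comparisons. *)
Lemma SNR_PRIS_le_NCR (R : realType) (M N : nat)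
    (P sigma2 beta1 beta2 beta3 alpha : R)
    (a : 'cV[R[i]]_M) (Q : 'M[R[i]]_M) :
  (1 <= M)%N -> 0 < P -> 0 < sigma2 -> 0 < beta1 -> 0 < beta2 ->
  quad_form Q a = 0 ->
  (SNR_PRIS M N P sigma2 beta1 beta2 beta3
     <= SNR_NCR P sigma2 beta1 beta2 beta3 a Q alpha)
  = (N%:R ^+ 2 <= alpha ^+ 2 * (1 - N%:R ^+ 2 * M%:R * beta2)).
Proof.
move=> M_ge1 P_gt0 s_gt0 b1_gt0 b2_gt0 Qa0.
have M_gt0 : 0 < M%:R :> R by rewrite ltr0n.
have d_gt0 : 0 < 1 + alpha ^+ 2 * beta2 * M%:R.
  apply: ltr_wpDr => //; apply: mulr_ge0 => //.
  by rewrite (pmulr_lge0 _ b2_gt0) sqr_ge0.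
rewrite -[LHS]subr_ge0 -[RHS]subr_ge0.
(* The [beta3] terms cancel. Up to the factor P M beta1 beta2 / sigma2 what remains is alpha^2 / (1
   + alpha^2 beta2 M) - N^2, put over its denominator. *)
have -> : SNR_NCR P sigma2 beta1 beta2 beta3 a Q alpha
    - SNR_PRIS M N P sigma2 beta1 beta2 beta3
  = P * M%:R * beta1 * beta2 / (sigma2 * (1 + alpha ^+ 2 * beta2 * M%:R))
    * (alpha ^+ 2 * (1 - N%:R ^+ 2 * M%:R * beta2) - N%:R ^+ 2).
  rewrite /SNR_NCR /SNR_PRIS Qa0 /=; field.
  by rewrite !lt0r_neq0.
by rewrite pmulr_rge0 // divr_gt0 ?mulr_gt0.
Qed.

Lemma SNR_ARIS_le_NCR (R : realType) (M N : nat)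
    (P sigma2 beta1 beta2 beta3 alphaA alpha : R)
    (a : 'cV[R[i]]_M) (Q : 'M[R[i]]_M) :
  (1 <= M)%N -> 0 < P -> 0 < sigma2 -> 0 < beta1 -> 0 < beta2 ->
  quad_form Q a = 0 ->
  (SNR_ARIS N P sigma2 beta1 beta2 beta3 a Q alphaA
     <= SNR_NCR P sigma2 beta1 beta2 beta3 a Q alpha)
  = ((alphaA * N%:R) ^+ 2
     <= alpha ^+ 2 * (1 - (N%:R ^+ 2 - N%:R) * alphaA ^+ 2 * M%:R * beta2)).
Proof.
move=> M_ge1 P_gt0 s_gt0 b1_gt0 b2_gt0 Qa0.
have M_gt0 : 0 < M%:R :> R by rewrite ltr0n.
have d_gt0 : 0 < 1 + alpha ^+ 2 * beta2 * M%:R.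
  apply: ltr_wpDr => //; apply: mulr_ge0 => //.
  by rewrite (pmulr_lge0 _ b2_gt0) sqr_ge0.
have dA_gt0 : 0 < 1 + alphaA ^+ 2 * beta2 * M%:R * N%:R.
  apply: ltr_wpDr => //; apply: mulr_ge0 => //.
  by rewrite (pmulr_lge0 _ M_gt0) (pmulr_lge0 _ b2_gt0) sqr_ge0.
rewrite -[LHS]subr_ge0 -[RHS]subr_ge0.
(* Cross-multiplying the two noise factors leaves two terms in alpha^2 alphaA^2 M beta2: +N from the
   noise amplified by the active RIS and -N^2 from its array gain. Hence the coefficient N^2 - N. *)
have -> : SNR_NCR P sigma2 beta1 beta2 beta3 a Q alpha
    - SNR_ARIS N P sigma2 beta1 beta2 beta3 a Q alphaA
  = P * M%:R * beta1 * beta2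
      / (sigma2 * (1 + alpha ^+ 2 * beta2 * M%:R)
         * (1 + alphaA ^+ 2 * beta2 * M%:R * N%:R))
    * (alpha ^+ 2 * (1 - (N%:R ^+ 2 - N%:R) * alphaA ^+ 2 * M%:R * beta2)
       - (alphaA * N%:R) ^+ 2).
  rewrite /SNR_NCR /SNR_ARIS Qa0 /=; field.
  by rewrite !lt0r_neq0.
by rewrite pmulr_rge0 // divr_gt0 ?mulr_gt0.
Qed.

Lemma sqr_le_sqrM (R : rcfType) (q e x : R) :
  0 <= q -> 0 < e -> 0 <= x ->
  (q ^+ 2 <= x ^+ 2 * e) = (q / Num.sqrt e <= x).
Proof.
move=> q_ge0 e_gt0 x_ge0.
rewrite ler_pdivrMr ?sqrtr_gt0 // -[RHS]ler_sqr ?nnegrE //.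
  by rewrite exprMn sqr_sqrtr // ltW.
by rewrite mulr_ge0 ?sqrtr_ge0.
Qed.

Lemma sqrM_le0_lt_sqr (R : realDomainType) (q e x : R) :
  0 < q -> e <= 0 -> x ^+ 2 * e < q ^+ 2.
Proof.
move=> q_gt0 e_le0; apply: le_lt_trans (exprn_gt0 2 q_gt0).
by rewrite mulr_ge0_le0 ?sqr_ge0.
Qed.

Theorem mainTheorem15 (R : realType) (M N : nat)
    (P sigma2 beta1 beta2 beta3 alphaA : R)
    (a21 : 'cV[R[i]]_M) (R3 : 'M[R[i]]_M)
    (M_ge1 : (1 <= M)%N) (N_ge1 : (1 <= N)%N)
    (P_gt0 : 0 < P) (sigma2_gt0 : 0 < sigma2)
    (beta1_gt0 : 0 < beta1) (beta2_gt0 : 0 < beta2) (beta3_gt0 : 0 < beta3)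
    (alphaA_gt0 : 0 < alphaA)
    (a21_unimodular : forall i : 'I_M, `|a21 i 0| = 1)
    (R3_psd : psdmx R3)
    (R3_trace : \tr R3 = (M%:R * beta3)%:C)
    (a21_null : quad_form R3 a21 = 0) :
  let snrP := SNR_PRIS M N P sigma2 beta1 beta2 beta3 in
  let snrA := SNR_ARIS N P sigma2 beta1 beta2 beta3 a21 R3 alphaA in
  let snrNCR alphaN := SNR_NCR P sigma2 beta1 beta2 beta3 a21 R3 alphaN in
  let snrP0 := SNR_PRIS_nodirect M N P sigma2 beta1 beta2 in
  let snrA0 := SNR_ARIS_nodirect N P sigma2 beta1 beta2 a21 alphaA in
  let snrNCR0 alphaN := SNR_NCR_nodirect P sigma2 beta1 beta2 a21 alphaN in
  (forall alphaN : R, 0 <= alphaN ->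
     (snrNCR alphaN >= snrP <-> snrNCR0 alphaN >= snrP0) /\
     (snrNCR alphaN >= snrA <-> snrNCR0 alphaN >= snrA0)) /\
  ((1 - N%:R ^+ 2 * M%:R * beta2 > 0 ->
      forall alphaN : R, 0 <= alphaN ->
        (snrNCR alphaN >= snrP <->
         alphaN >= N%:R / Num.sqrt (1 - N%:R ^+ 2 * M%:R * beta2))) /\
   (N%:R ^+ 2 * M%:R * beta2 >= 1 ->
      forall alphaN : R, 0 <= alphaN -> snrP > snrNCR alphaN)) /\
  ((1 - (N%:R ^+ 2 - N%:R) * alphaA ^+ 2 * M%:R * beta2 > 0 ->
      forall alphaN : R, 0 <= alphaN ->
        (snrNCR alphaN >= snrA <->
         alphaN >= alphaA * N%:R
           / Num.sqrt (1 - (N%:R ^+ 2 - N%:R) * alphaA ^+ 2 * M%:R * beta2))) /\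
   ((N%:R ^+ 2 - N%:R) * alphaA ^+ 2 * M%:R * beta2 >= 1 ->
      forall alphaN : R, 0 <= alphaN -> snrA > snrNCR alphaN)).
Proof.
move=> /=.
have N_gt0 : 0 < N%:R :> R by rewrite ltr0n.
have AN_gt0 : 0 < alphaA * N%:R by rewrite mulr_gt0.
have Z := @quad_form0 R M a21.
split=> [x _|].
  rewrite /SNR_PRIS_nodirect /SNR_ARIS_nodirect /SNR_NCR_nodirect.
  (* With and without the direct link, each comparison reduces to the same inequality; [Z] provides
     the vanishing form for the zero matrix. *)
  by rewrite !SNR_PRIS_le_NCR // !SNR_ARIS_le_NCR.
split; split=> [e_gt0 x x_ge0|e_ge1 x _].
- by rewrite SNR_PRIS_le_NCR // sqr_le_sqrM // ltW.
(* The strict claim is the negation of the comparison. It holds even at e = 0, because N >= 1 makes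
   q^2 positive. *)
- by rewrite ltNge SNR_PRIS_le_NCR // -ltNge sqrM_le0_lt_sqr // subr_le0.
- by rewrite SNR_ARIS_le_NCR // sqr_le_sqrM // ltW.
- by rewrite ltNge SNR_ARIS_le_NCR // -ltNge sqrM_le0_lt_sqr // subr_le0.
Qed.
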